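(* Let $p$ be an odd prime number, and let $Y/X$ be a Galois cover of finite graphs with Galois group $\Delta = \mathrm{Gal}(Y/X)$ isomorphic to $\mathbb{F}_p^\times$. Let $C = \mathrm{Pic}^0(Y)/p\,\mathrm{Pic}^0(Y)$ be the maximal $p$-elementary abelian quotient of $\mathrm{Pic}^0(Y)$, viewed as an $\mathbb{F}_p[\Delta]$-module. Then, for every non-trivial character $\psi: \Delta \to \mathbb{F}_p^\times$, one has $$e_\psi C \neq 0 \quad\text{if and only if}\quad h_{Y/X}(1,\psi) = 0 \text{ in } \mathbb{F}_p.$$
   Context: Graphs are in Serre's formalism: a finite graph $Y$ consists of a finite vertex set $V_Y$, a finite set $\mathbf{E}_Y$ of directed edges, an incidence map $\varepsilon \mapsto (o(\varepsilon),t(\varepsilon)) \in V_Y\times V_Y$, and a fixed-point-free involution $\varepsilon \mapsto \bar\varepsilon$ of $\mathbf{E}_Y$ with $o(\bar\varepsilon)=t(\varepsilon)$ and $t(\bar\varepsilon)=o(\varepsilon)$ (loops and multiple edges are allowed). For $w \in V_Y$, put $\mathbf{E}_{Y,w} = \{\varepsilon : o(\varepsilon)=w\}$ and $\mathrm{val}_Y(w) = \#\mathbf{E}_{Y,w}$. A Galois cover $Y/X$ consists of connected finite graphs $X,Y$ and a graph morphism $f:Y\to X$, surjective on vertices, that restricts to a bijection $\mathbf{E}_{Y,w}\to\mathbf{E}_{X,f(w)}$ for every $w\in V_Y$, and such that the group $G=\mathrm{Gal}(Y/X)$ of deck transformations (automorphisms $\sigma$ of $Y$ with $f\circ\sigma=f$)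 acts transitively on the fibre $f^{-1}(v)$ for each $v\in V_X$; the action of $G$ on $V_Y$ is then free. $\mathrm{Div}(Y)$ is the free abelian group on $V_Y$; $\mathrm{Div}^0(Y)$ is the kernel of the augmentation $\mathrm{Div}(Y)\to\mathbb{Z}$, $w\mapsto 1$. Define operators on $\mathrm{Div}(Y)$ by $\mathcal{D}(w)=\mathrm{val}_Y(w)\cdot w$, $\mathcal{A}(w)=\sum_{\varepsilon\in\mathbf{E}_{Y,w}}t(\varepsilon)$, and $\mathcal{L}=\mathcal{D}-\mathcal{A}$. Put $\mathrm{Pic}^0(Y)=\mathrm{Div}^0(Y)/\mathcal{L}(\mathrm{Div}(Y))$, a finite abelian group on which $\mathrm{Gal}(Y/X)$ acts. When $G=\mathrm{Gal}(Y/X)$ is abelian, $\mathrm{Div}(Y)$ is a free $\mathbb{Z}[G]$-module of rank $\#V_X$, and $\mathcal{D},\mathcal{A}$ are $\mathbb{Z}[G]$-linear. Set $\eta_{Y/X}(u)=\det_{\mathbb{Z}[G]}(\mathcal{I}-\mathcal{A}u+(\mathcal{D}-\mathcal{I})u^2)\in\mathbb{Z}[G][u]$, where $\mathcal{I}$ is the identity; in particular $\eta_{Y/X}(1)=\det_{\mathbb{Z}[G]}(\mathcal{L})\in\mathbb{Z}[G]$. For a commutative ring $R$ and a character $\psi:G\to R^\times$, extend $\psi$ to the ring morphism $\psi:\mathbb{Z}[G]\to R$ and put $h_{Y/X}(1,\psi)=\psi(\eta_{Y/X}(1))\in R$. For $\psi:\Delta\to\mathbb{F}_p^\times$, $e_\psi=\frac{1}{\#\Delta}\sum_{\sigma\in\Delta}\psi(\sigma)\sigma^{-1}\in\mathbb{F}_p[\Delta]$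 is the corresponding idempotent. *)

(* Defs.v *)
From HB Require Import structures.
From mathcomp Require Import all_boot all_order all_algebra all_fingroup.
From mathcomp Require Import generic_quotient ring_quotient.
From mathcomp Require Import boolp.

Set Implicit Arguments.
Unset Strict Implicit.
Unset Printing Implicit Defensive.

Import GRing.Theory.
Local Open Scope ring_scope.
Local Open Scope quotient_scope.

Definition gring (R : nzRingType) (gT : finGroupType) := {ffun gT -> R}.

HB.instance Definition _ (R : nzRingType) (gT : finGroupType) :=
  GRing.Zmodule.on (gring R gT).

Section GroupRing.
Variables (R : nzRingType) (gT : finGroupType).
Implicit Types (a b c : gring R gT) (g h : gT).

Definition gmon (r : R) (g : gT) : gring R gT :=
  [ffun h => if h == g then r else 0].

Definition gring_mul a b : gring R gT :=
  [ffun g => \sum_h a h * b (h^-1 * g)%g].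

Lemma gring_mulA : associative gring_mul.
Proof.
move=> a b c; apply/ffunP=> g; rewrite !ffunE.
under eq_bigr => k _ do rewrite ffunE (reindex_inj (mulgI k^-1%g)) big_distrr /=.
rewrite exchange_big /=; apply: eq_bigr => h _.
rewrite ffunE big_distrl /=; apply: eq_bigr => k _.
by rewrite mulrA invMg invgK -!mulgA mulKVg.
Qed.

Lemma gring_mul1 : left_id (gmon 1 1) gring_mul.
Proof.
move=> a; apply/ffunP=> g; rewrite ffunE (bigD1 1%g) //= big1 => [|h h1].
  by rewrite ffunE eqxx mul1r invg1 mul1g addr0.
by rewrite ffunE (negPf h1) mul0r.
Qed.

Lemma gring_mulr1 : right_id (gmon 1 1) gring_mul.
Proof.
move=> a; apply/ffunP=> g; rewrite ffunE (bigD1 g) //= big1 => [|h hg].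
  by rewrite ffunE mulVg eqxx mulr1 addr0.
by rewrite ffunE -eq_mulVg1 (negPf hg) mulr0.
Qed.

Lemma gring_mulDl : left_distributive gring_mul +%R.
Proof.
move=> a b c; apply/ffunP=> g; rewrite !ffunE -big_split /=.
by apply: eq_bigr => h _; rewrite ffunE mulrDl.
Qed.

Lemma gring_mulDr : right_distributive gring_mul +%R.
Proof.
move=> a b c; apply/ffunP=> g; rewrite !ffunE -big_split /=.
by apply: eq_bigr => h _; rewrite ffunE mulrDr.
Qed.

Lemma gring_1neq0 : gmon 1 1 != 0 :> gring R gT.
Proof.
by apply/eqP=> /ffunP/(_ 1%g)/eqP; rewrite !ffunE eqxx oner_eq0.
Qed.

HB.instance Definition _ := GRing.Zmodule_isNzRing.Build (gring R gT)
  gring_mulA gring_mul1 gring_mulr1 gring_mulDl gring_mulDr gring_1neq0.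

(* Module laws for the R[G]-action deduced from a G-action and an R-scaling. *)
Variables (V : zmodType) (sc : R -> V -> V) (act : gT -> V -> V).
Hypotheses (scA : forall r s v, sc r (sc s v) = sc (r * s) v)
  (sc1 : left_id 1 sc) (scDr : right_distributive sc +%R)
  (scDl : forall v, {morph sc^~ v : r s / r + s})
  (actM : forall g h v, act (g * h) v = act g (act h v))
  (act1 : forall v, act 1 v = v)
  (actD : forall g, {morph act g : u v / u + v})
  (act_sc : forall g r v, act g (sc r v) = sc r (act g v)).

Definition gscale (a : gring R gT) (v : V) : V := \sum_g sc (a g) (act g v).

Let sc0l v : sc 0 v = 0.
Proof. by apply: (addIr (sc 0 v)); rewrite -scDl !add0r. Qed.
Let sc0r r : sc r 0 = 0.
Proof. by apply: (addIr (sc r 0)); rewrite -scDr !add0r. Qed.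
Let act0 g : act g 0 = 0.
Proof. by apply: (addIr (act g 0)); rewrite -actD !add0r. Qed.

Lemma gscaleA a b v : gscale a (gscale b v) = gscale (a * b) v.
Proof.
rewrite /gscale.
transitivity (\sum_h \sum_g sc (a h * b g) (act (h * g)%g v)).
  apply: eq_bigr => h _.
  rewrite (big_morph _ (actD h) (act0 h)) (big_morph _ (scDr _) (sc0r _)).
  by apply: eq_bigr => g _; rewrite act_sc scA actM.
under eq_bigr => h _ do rewrite (reindex_inj (mulgI h^-1%g)).
rewrite exchange_big /=; apply: eq_bigr => g _.
rewrite ffunE (big_morph _ (scDl _) (sc0l _)).
by apply: eq_bigr => h _; rewrite mulKVg.
Qed.

Lemma gscale1 : left_id 1 gscale.
Proof.
move=> v; rewrite /gscale (bigD1 1%g) //= big1 => [|g g1].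
  by rewrite ffunE eqxx sc1 act1 addr0.
by rewrite ffunE (negPf g1) sc0l.
Qed.

Lemma gscaleDr : right_distributive gscale +%R.
Proof.
move=> a u v; rewrite /gscale -big_split /=.
by apply: eq_bigr => g _; rewrite actD scDr.
Qed.

Lemma gscaleDl v : {morph gscale^~ v : a b / a + b}.
Proof.
move=> a b; rewrite /gscale -big_split /=.
by apply: eq_bigr => g _; rewrite ffunE scDl.
Qed.

End GroupRing.

(* A ring morphism when [psi] is multiplicative. *)
Definition gring_ext (gT : finGroupType) (R : comNzRingType) (psi : gT -> R)
    (a : gring int gT) : R :=
  \sum_g (a g)%:~R * psi g.

Section Cokernel.
Variables (U V : zmodType) (f : {additive U -> V}).

Definition zimage : {pred V} := fun y => `[< exists x, f x = y >].

Fact zimage_zmod_closed : zmod_closed zimage.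
Proof.
split=> [|x y /asboolP[a <-] /asboolP[b <-]]; apply/asboolP.
  by exists 0; rewrite raddf0.
by exists (a - b); rewrite raddfB.
Qed.

HB.instance Definition _ := GRing.isZmodClosed.Build V zimage zimage_zmod_closed.

Definition coker := Quotient.quot zimage.
HB.instance Definition _ := GRing.Zmodule.on coker.

Definition to_coker (y : V) : coker := \pi y.

(* The endomorphism of the cokernel induced by [g]; it is meaningful when [g]
   preserves the image of [f], see [coker_mapE]. *)
Definition coker_map (g : V -> V) (y : coker) : coker := to_coker (g (repr y)).

Lemma to_coker_is_additive : zmod_morphism to_coker.
Proof. by move=> x y; rewrite /to_coker; exact: (raddfB (\pi_(coker))). Qed.
HB.instance Definition _ :=
  GRing.isZmodMorphism.Build V coker to_coker to_coker_is_additive.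

Lemma to_coker_eq x y : to_coker x = to_coker y <-> exists u, f u = x - y.
Proof.
rewrite /to_coker; split=> [/eqP|[u E]].
  by rewrite -Quotient.idealrBE => /asboolP.
by apply/eqP; rewrite -Quotient.idealrBE; apply/asboolP; exists u.
Qed.

Lemma to_cokerK y : to_coker (repr y) = y.
Proof. exact: reprK. Qed.

Lemma coker_mapE (g : {additive V -> V}) (g' : U -> U) :
  (forall u, g (f u) = f (g' u)) ->
  forall y, coker_map g (to_coker y) = to_coker (g y).
Proof.
move=> gf y; apply/to_coker_eq.
have /to_coker_eq[u E] := to_cokerK (to_coker y).
by exists (g' u); rewrite -gf E raddfB.
Qed.

End Cokernel.

Lemma coker_map_additive (U V : zmodType) (f : {additive U -> V})
    (g : {additive V -> V}) (g' : U -> U) :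
  (forall u, g (f u) = f (g' u)) -> zmod_morphism (@coker_map _ _ f g).
Proof.
move=> gf y z; rewrite -(to_cokerK y) -(to_cokerK z) -raddfB.
by rewrite !(coker_mapE gf) !raddfB.
Qed.

Record graph := Graph {
  vert : finType;
  edge : finType;
  org : edge -> vert;
  tgt : edge -> vert;
  ebar : edge -> edge;
  ebarK : involutive ebar;
  ebar_neq : forall e, ebar e != e;
  org_ebar : forall e, org (ebar e) = tgt e;
  tgt_ebar : forall e, tgt (ebar e) = org e
}.

Definition star (Y : graph) (w : vert Y) : {set edge Y} := [set e | org e == w].

Definition valency (Y : graph) (w : vert Y) : nat := #|star w|.

Definition adjacent (Y : graph) : rel (vert Y) :=
  fun v w => [exists e : edge Y, (org e == v) && (tgt e == w)].

Definition connected_graph (Y : graph) : Prop :=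
  (0 < #|vert Y|)%N /\ forall v w : vert Y, connect (@adjacent Y) v w.

Record graph_hom (Y X : graph) := GraphHom {
  hom_vert : vert Y -> vert X;
  hom_edge : edge Y -> edge X;
  hom_org : forall e, org (hom_edge e) = hom_vert (org e);
  hom_tgt : forall e, tgt (hom_edge e) = hom_vert (tgt e);
  hom_ebar : forall e, hom_edge (ebar e) = ebar (hom_edge e)
}.

Section Deck.
Variables (Y X : graph) (f : graph_hom Y X).

Definition is_deck (s : {perm vert Y} * {perm edge Y}) : bool :=
  [&& [forall e, org (s.2 e) == s.1 (org e)],
      [forall e, tgt (s.2 e) == s.1 (tgt e)],
      [forall e, s.2 (ebar e) == ebar (s.2 e)],
      [forall w, hom_vert f (s.1 w) == hom_vert f w]
    & [forall e, hom_edge f (s.2 e) == hom_edge f e]].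

Record deck := Deck { deck_perm : {perm vert Y} * {perm edge Y};
                      deck_permP : is_deck deck_perm }.

HB.instance Definition _ := [isSub for deck_perm].
HB.instance Definition _ := [Finite of deck by <:].

Definition deck_vert (s : deck) : vert Y -> vert Y := (deck_perm s).1.
Definition deck_edge (s : deck) : edge Y -> edge Y := (deck_perm s).2.

Lemma is_deckP (s : {perm vert Y} * {perm edge Y}) :
  reflect [/\ forall e, org (s.2 e) = s.1 (org e),
              forall e, tgt (s.2 e) = s.1 (tgt e),
              forall e, s.2 (ebar e) = ebar (s.2 e),
              forall w, hom_vert f (s.1 w) = hom_vert f w
            & forall e, hom_edge f (s.2 e) = hom_edge f e] (is_deck s).
Proof.
apply: (iffP and5P) => -[h1 h2 h3 h4 h5].
  by split=> x; apply/eqP; [move/forallP: h1 | move/forallP: h2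
    | move/forallP: h3 | move/forallP: h4 | move/forallP: h5]; exact.
by split; apply/forallP=> x; apply/eqP.
Qed.

Fact is_deck1 : is_deck (1%g, 1%g).
Proof. by apply/is_deckP; split=> x; rewrite !perm1. Qed.

Fact is_deckM (s t : {perm vert Y} * {perm edge Y}) : is_deck s -> is_deck t -> is_deck (s * t)%g.
Proof.
move=> /is_deckP[s1 s2 s3 s4 s5] /is_deckP[t1 t2 t3 t4 t5].
by apply/is_deckP; split=> x; rewrite !permM ?t1 ?t2 ?t3 ?t4 ?t5
  ?s1 ?s2 ?s3 ?s4 ?s5.
Qed.

Fact is_deckV (s : {perm vert Y} * {perm edge Y}) : is_deck s -> is_deck (s^-1)%g.
Proof.
move=> /is_deckP[s1 s2 s3 s4 s5]; apply/is_deckP; split=> x.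
- by apply: (@perm_inj _ s.1); rewrite -s1 !permKV.
- by apply: (@perm_inj _ s.1); rewrite -s2 !permKV.
- by apply: (@perm_inj _ s.2); rewrite s3 !permKV.
- by rewrite -s4 permKV.
- by rewrite -s5 permKV.
Qed.

(* Products in [{perm T}] are composed from left to right; we reverse them so
   that [deck_vert (s * t) = deck_vert s \o deck_vert t] and decks act on the
   left. *)
Definition deck_one : deck := Deck is_deck1.
Definition deck_mul (s t : deck) : deck :=
  Deck (is_deckM (deck_permP t) (deck_permP s)).
Definition deck_inv (s : deck) : deck := Deck (is_deckV (deck_permP s)).

Fact deck_mulA : associative deck_mul.
Proof. by move=> s t u; apply: val_inj; rewrite /= mulgA. Qed.
Fact deck_mul1 : left_id deck_one deck_mul.
Proof. by move=> s; apply: val_inj; rewrite /= mulg1. Qed.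
Fact deck_mulV : left_inverse deck_one deck_inv deck_mul.
Proof. by move=> s; apply: val_inj; rewrite /= mulgV. Qed.

HB.instance Definition _ :=
  Finite_isGroup.Build deck deck_mulA deck_mul1 deck_mulV.

Lemma deck_vert1 w : deck_vert 1%g w = w.
Proof. exact: perm1. Qed.

Lemma deck_vertM (s t : deck) w :
  deck_vert (s * t)%g w = deck_vert s (deck_vert t w).
Proof. exact: permM. Qed.

Lemma deck_edgeM (s t : deck) e :
  deck_edge (s * t)%g e = deck_edge s (deck_edge t e).
Proof. exact: permM. Qed.

Lemma deck_edge1 e : deck_edge 1%g e = e.
Proof. exact: perm1. Qed.

Lemma deck_vertK s : cancel (deck_vert s) (deck_vert s^-1%g).
Proof. by move=> w; rewrite -deck_vertM mulVg deck_vert1. Qed.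

Lemma deck_vertKV s : cancel (deck_vert s^-1%g) (deck_vert s).
Proof. by move=> w; rewrite -deck_vertM mulgV deck_vert1. Qed.

Lemma deck_edgeK s : cancel (deck_edge s) (deck_edge s^-1%g).
Proof. by move=> e; rewrite -deck_edgeM mulVg deck_edge1. Qed.

Lemma deck_edgeKV s : cancel (deck_edge s^-1%g) (deck_edge s).
Proof. by move=> e; rewrite -deck_edgeM mulgV deck_edge1. Qed.

Lemma deck_vert_inj s : injective (deck_vert s).
Proof. exact: can_inj (deck_vertK s). Qed.

Lemma deck_org s e : org (deck_edge s e) = deck_vert s (org e).
Proof. by case/is_deckP: (deck_permP s) => h1 h2 h3 h4 h5; rewrite /deck_vert /deck_edge ?h1 ?h2 ?h4 ?h5. Qed.

Lemma deck_tgt s e : tgt (deck_edge s e) = deck_vert s (tgt e).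
Proof. by case/is_deckP: (deck_permP s) => h1 h2 h3 h4 h5; rewrite /deck_vert /deck_edge ?h1 ?h2 ?h4 ?h5. Qed.

Lemma deck_hom_vert s w : hom_vert f (deck_vert s w) = hom_vert f w.
Proof. by case/is_deckP: (deck_permP s) => h1 h2 h3 h4 h5; rewrite /deck_vert /deck_edge ?h1 ?h2 ?h4 ?h5. Qed.

Lemma deck_hom_edge s e : hom_edge f (deck_edge s e) = hom_edge f e.
Proof. by case/is_deckP: (deck_permP s) => h1 h2 h3 h4 h5; rewrite /deck_vert /deck_edge ?h1 ?h2 ?h4 ?h5. Qed.

End Deck.

Record galois_cover (Y X : graph) := GaloisCover {
  cover_hom :> graph_hom Y X;
  cover_conn_top : connected_graph Y;
  cover_conn_base : connected_graph X;
  cover_surj : forall v, exists w, hom_vert cover_hom w == v;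
  cover_star_inj : forall w, {in star w &, injective (hom_edge cover_hom)};
  cover_star_surj :
    forall w, hom_edge cover_hom @: star w = star (hom_vert cover_hom w);
  cover_trans : forall w w' : vert Y, hom_vert cover_hom w = hom_vert cover_hom w' ->
    exists s : deck cover_hom, deck_vert s w = w'
}.

Definition divisor (Y : graph) := {ffun vert Y -> int}.
HB.instance Definition _ (Y : graph) := GRing.Zmodule.on (divisor Y).

Section Divisors.
Variable Y : graph.
Implicit Types (d : divisor Y) (w : vert Y).

Definition pt w : divisor Y := [ffun w' => (w' == w)%:R].

Definition linext (F : vert Y -> divisor Y) d : divisor Y := \sum_w F w *~ d w.

Fact linext_is_additive F : zmod_morphism (linext F).
Proof.
move=> a b; rewrite /linext -sumrB; apply: eq_bigr => w _.
by rewrite !ffunE mulrzBr.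
Qed.
HB.instance Definition _ F :=
  GRing.isZmodMorphism.Build (divisor Y) (divisor Y) (linext F)
    (linext_is_additive F).

Definition degOp : divisor Y -> divisor Y :=
  linext (fun w => pt w *+ valency w).
Definition adjOp : divisor Y -> divisor Y :=
  linext (fun w => \sum_(e in star w) pt (tgt e)).
HB.instance Definition _ := GRing.Additive.on degOp.
HB.instance Definition _ := GRing.Additive.on adjOp.

Definition lapOp d : divisor Y := degOp d - adjOp d.

Definition augm d : int := \sum_w d w.

Lemma linext_pt F w : linext F (pt w) = F w.
Proof.
rewrite /linext (bigD1 w) //= big1 => [|v vw]; first by rewrite ffunE eqxx addr0.
by rewrite ffunE (negPf vw).
Qed.

Lemma augm_is_additive : zmod_morphism augm.
Proof.
by move=> a b; rewrite /augm -sumrB; apply: eq_bigr => w _; rewrite !ffunE.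
Qed.
HB.instance Definition _ :=
  GRing.isZmodMorphism.Build (divisor Y) int augm augm_is_additive.

Lemma augm_pt w : augm (pt w) = 1.
Proof.
rewrite /augm (bigD1 w) //= big1 => [|v vw]; first by rewrite ffunE eqxx addr0.
by rewrite ffunE (negPf vw).
Qed.

Lemma augm_linext F d : augm (linext F d) = \sum_w augm (F w) *~ d w.
Proof. by rewrite raddf_sum; apply: eq_bigr => w _; rewrite raddfMz. Qed.

Definition deg_zero : {pred divisor Y} := fun d => augm d == 0.

Fact deg_zero_closed : zmod_closed deg_zero.
Proof.
split=> [|x y /eqP x0 /eqP y0]; apply/eqP; rewrite ?raddf0 //.
by rewrite raddfB /= x0 y0 subrr.
Qed.
HB.instance Definition _ :=
  GRing.isZmodClosed.Build (divisor Y) deg_zero deg_zero_closed.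

Record div0 := Div0 { div0_val : divisor Y; div0P : div0_val \in deg_zero }.
HB.instance Definition _ := [isSub for div0_val].
HB.instance Definition _ := [Choice of div0 by <:].
HB.instance Definition _ := [SubChoice_isSubZmodule of div0 by <:].

Fact lapOp_is_additive : zmod_morphism lapOp.
Proof.
by move=> a b; rewrite /lapOp (raddfB degOp) (raddfB adjOp) /= !opprD addrACA.
Qed.
HB.instance Definition _ :=
  GRing.isZmodMorphism.Build (divisor Y) (divisor Y) lapOp lapOp_is_additive.

Fact lapOp_deg_zero d : lapOp d \in deg_zero.
Proof.
apply/eqP; rewrite /lapOp raddfB /= !augm_linext -sumrB big1 // => w _.
rewrite -mulrzBl raddfMn /= augm_pt (raddf_sum augm) /=.
have -> : \sum_(e in star w) augm (pt (tgt e)) = 1 *+ valency w.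
  by rewrite -sumr_const; apply: eq_bigr => e _; rewrite augm_pt.
by rewrite subrr mul0rz.
Qed.

Definition laplacian d : div0 := Div0 (lapOp_deg_zero d).

Fact laplacian_is_additive : zmod_morphism laplacian.
Proof. by move=> a b; apply: val_inj; rewrite /= raddfB. Qed.
HB.instance Definition _ :=
  GRing.isZmodMorphism.Build (divisor Y) div0 laplacian laplacian_is_additive.

Definition pic0 := coker laplacian.
HB.instance Definition _ := GRing.Zmodule.on pic0.

End Divisors.

Definition mul_by (V : zmodType) (p : nat) (x : V) : V := x *+ p.
HB.instance Definition _ (V : zmodType) (p : nat) :=
  GRing.isZmodMorphism.Build V V (mul_by p) (fun x y => mulrnBl p x y).

Definition mod_mul (V : zmodType) (p : nat) := coker (@mul_by V p).
HB.instance Definition _ (V : zmodType) (p : nat) := GRing.Zmodule.on (mod_mul V p).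

(* Alias carrying the Z[G]-module structure; [f] only serves to determine G. *)
Definition divG (Y X : graph) (f : graph_hom Y X) := divisor Y.

(* Alias carrying the F_p[G]-module structure; primality of [p] is needed for
   ['F_p] to be the ring of integers modulo [p]. *)
Definition pic_mod (Y X : graph) (f : graph_hom Y X) (p : nat) (_ : prime p) :=
  mod_mul (pic0 Y) p.

Section Action.
Variables (Y X : graph) (f : graph_hom Y X).
Implicit Types (s t : deck f) (d : divisor Y) (w : vert Y).

Definition act_div s : divisor Y -> divisor Y :=
  linext (fun w => pt (deck_vert s w)).

HB.instance Definition _ s := GRing.Additive.on (act_div s).

Lemma act_divE s d w : act_div s d w = d (deck_vert s^-1%g w).
Proof.
rewrite /act_div /linext sum_ffunE (bigD1 (deck_vert s^-1%g w)) //= big1 => [|v vw].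
  by rewrite ffunMzE ffunE deck_vertKV eqxx intz addr0.
rewrite ffunMzE ffunE; case: eqP => [E|_]; last by rewrite mul0rz.
by rewrite E deck_vertK eqxx in vw.
Qed.

Lemma act_div_pt s w : act_div s (pt w) = pt (deck_vert s w).
Proof. exact: linext_pt. Qed.

Lemma act_div1 d : act_div 1%g d = d.
Proof. by apply/ffunP=> w; rewrite act_divE invg1 deck_vert1. Qed.

Lemma act_divM s t d : act_div (s * t)%g d = act_div s (act_div t d).
Proof. by apply/ffunP=> w; rewrite !act_divE invMg deck_vertM. Qed.

Fact augm_act s d : augm (act_div s d) = augm d.
Proof.
rewrite /augm [RHS](reindex_inj (@deck_vert_inj _ _ _ s^-1%g)).
by apply: eq_bigr => w _; rewrite act_divE.
Qed.

Fact act_div_deg_zero s (x : div0 Y) : act_div s (val x) \in @deg_zero Y.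
Proof. by apply/eqP; rewrite augm_act; apply/eqP: (div0P x). Qed.

Definition act_div0 s (x : div0 Y) : div0 Y := Div0 (act_div_deg_zero s x).

Fact act_div0_is_additive s : zmod_morphism (act_div0 s).
Proof. by move=> a b; apply: val_inj; rewrite /= raddfB. Qed.
HB.instance Definition _ s := GRing.isZmodMorphism.Build (div0 Y) (div0 Y)
  (act_div0 s) (act_div0_is_additive s).

Lemma act_linext s (F : vert Y -> divisor Y) :
  (forall w, act_div s (F w) = F (deck_vert s w)) ->
  forall d, act_div s (linext F d) = linext F (act_div s d).
Proof.
move=> sF d; rewrite /(linext F) raddf_sum [RHS](reindex_inj (@deck_vert_inj _ _ _ s)).
by apply: eq_bigr => w _; rewrite raddfMz /= sF act_divE deck_vertK.
Qed.

Lemma deck_valency s w : valency (deck_vert s w) = valency w.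
Proof.
rewrite /valency -(card_imset (star w) (can_inj (deck_edgeK s))).
apply: eq_card => e; rewrite inE; apply/eqP/imsetP => [ew|[e' + ->]].
  exists (deck_edge s^-1%g e); last by rewrite deck_edgeKV.
  by rewrite inE deck_org ew deck_vertK.
by rewrite inE deck_org => /eqP ->.
Qed.

Lemma act_degOp s d : act_div s (degOp d) = degOp (act_div s d).
Proof.
by apply: act_linext => w; rewrite raddfMn /= act_div_pt deck_valency.
Qed.

Lemma act_adjOp s d : act_div s (adjOp d) = adjOp (act_div s d).
Proof.
apply: act_linext => w; rewrite raddf_sum /=.
rewrite [RHS](reindex_inj (can_inj (deck_edgeK s))) /=.
apply: eq_big => e; last by rewrite act_div_pt deck_tgt.
by rewrite !inE deck_org (inj_eq (@deck_vert_inj _ _ _ s)).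
Qed.

Lemma act_laplacian s d :
  act_div0 s (laplacian d) = laplacian (act_div s d).
Proof. by apply: val_inj; rewrite /= /lapOp raddfB /= act_degOp act_adjOp. Qed.

Definition act_pic0 s : pic0 Y -> pic0 Y := coker_map (act_div0 s).
HB.instance Definition _ s := GRing.isZmodMorphism.Build (pic0 Y) (pic0 Y)
  (act_pic0 s) (coker_map_additive (act_laplacian s)).

Lemma act_pic0E s (x : div0 Y) :
  act_pic0 s (to_coker _ x) = to_coker _ (act_div0 s x).
Proof. exact: (coker_mapE (act_laplacian s)). Qed.

Fact act_pic0_mul_by p s (x : pic0 Y) :
  act_pic0 s (mul_by p x) = mul_by p (act_pic0 s x).
Proof. exact: raddfMn. Qed.

Definition act_mod p s : mod_mul (pic0 Y) p -> mod_mul (pic0 Y) p :=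
  coker_map (act_pic0 s).
HB.instance Definition _ p s := GRing.isZmodMorphism.Build
  (mod_mul (pic0 Y) p) (mod_mul (pic0 Y) p)
  (act_mod s) (coker_map_additive (act_pic0_mul_by p s)).

Lemma act_modE p s (x : pic0 Y) :
  @act_mod p s (to_coker _ x) = to_coker _ (act_pic0 s x).
Proof. exact: (coker_mapE (act_pic0_mul_by p s)). Qed.

Lemma act_pic01 (x : pic0 Y) : act_pic0 1%g x = x.
Proof.
rewrite -(to_cokerK x) act_pic0E; congr to_coker.
by apply: val_inj; rewrite /= act_div1.
Qed.

Lemma act_pic0M s t (x : pic0 Y) :
  act_pic0 (s * t)%g x = act_pic0 s (act_pic0 t x).
Proof.
rewrite -(to_cokerK x) [act_pic0 t _]act_pic0E !act_pic0E; congr to_coker.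
by apply: val_inj; rewrite /= act_divM.
Qed.

Lemma act_mod1 p (x : mod_mul (pic0 Y) p) : act_mod 1%g x = x.
Proof. by rewrite -(to_cokerK x) act_modE act_pic01. Qed.

Lemma act_modM p s t (x : mod_mul (pic0 Y) p) :
  act_mod (s * t)%g x = act_mod s (act_mod t x).
Proof. by rewrite -(to_cokerK x) [act_mod t _]act_modE !act_modE act_pic0M. Qed.

Local Notation divG := (divG f).
HB.instance Definition _ := GRing.Zmodule.on divG.

Let zsc (n : int) (d : divG) : divG := d *~ n.

Fact zscA n m d : zsc n (zsc m d) = zsc (n * m) d.
Proof. by rewrite /zsc mulrC mulrzA. Qed.
Fact zsc1 : left_id 1 zsc. Proof. by move=> d; exact: mulr1z. Qed.
Fact zscDr : right_distributive zsc +%R.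
Proof. by move=> n a b; exact: mulrzDl. Qed.
Fact zscDl d : {morph zsc^~ d : n m / n + m}.
Proof. by move=> n m; exact: mulrzDr. Qed.
Fact act_divD s : {morph act_div s : a b / a + b}.
Proof. exact: raddfD. Qed.
Fact act_div_zsc s n d : act_div s (zsc n d) = zsc n (act_div s d).
Proof. exact: raddfMz. Qed.

HB.instance Definition _ :=
  GRing.Zmodule_isLmodule.Build (gring int (deck f)) divG
    (gscaleA zscA zscDr zscDl act_divM act_divD act_div_zsc)
    (gscale1 zsc1 zscDl act_div1) (gscaleDr zscDr act_divD)
    (gscaleDl act_div zscDl).

Section PicModP.
Variables (p : nat) (p_pr : prime p).

Local Notation C := (pic_mod f p_pr).
HB.instance Definition _ := GRing.Zmodule.on C.

Let psc (r : 'F_p) (x : C) : C := x *+ (r : nat).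

Fact pic_mod_mulp (x : C) : x *+ p = 0.
Proof.
rewrite -(to_cokerK x) -[_ *+ p](raddfMn (to_coker (@mul_by (pic0 Y) p))).
rewrite -[RHS](raddf0 (to_coker (@mul_by (pic0 Y) p))).
by apply/to_coker_eq; exists (repr x); rewrite subr0.
Qed.

Fact pic_mod_modn (x : C) n : x *+ (n %% p) = x *+ n.
Proof.
by rewrite [in RHS](divn_eq n p) mulrnDr mulnC mulrnA pic_mod_mulp mul0rn add0r.
Qed.

Let Fp_nat (n : nat) (x : C) : x *+ (n %% (Zp_trunc (pdiv p)).+2) = x *+ n.
Proof. by rewrite Fp_cast // pic_mod_modn. Qed.

Fact pscA (r t : 'F_p) (x : C) : psc r (psc t x) = psc (r * t) x.
Proof. by rewrite /psc /= Fp_nat mulnC mulrnA. Qed.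
Fact psc1 : left_id 1 psc. Proof. by move=> x; rewrite /psc /= Fp_nat. Qed.
Fact pscDr : right_distributive psc +%R.
Proof. by move=> r a b; exact: mulrnDl. Qed.
Fact pscDl x : {morph psc^~ x : a b / a + b}.
Proof. by move=> r t; rewrite /psc /= Fp_nat mulrnDr. Qed.
Fact act_modD s : {morph @act_mod p s : a b / a + b}.
Proof. exact: raddfD. Qed.
Fact act_mod_psc s (r : 'F_p) (x : C) : act_mod s (psc r x) = psc r (act_mod s x).
Proof. exact: raddfMn. Qed.

HB.instance Definition _ :=
  GRing.Zmodule_isLmodule.Build (gring 'F_p (deck f)) C
    (gscaleA pscA pscDr pscDl (@act_modM p) act_modD act_mod_psc)
    (gscale1 psc1 pscDl (@act_mod1 p)) (gscaleDr pscDr act_modD)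
    (gscaleDl (@act_mod p) pscDl).

Definition psi_idem (psi : {morphism [set: deck f] >-> {unit 'F_p}}) :
    gring 'F_p (deck f) :=
  \sum_(s : deck f) gmon ((#|{: deck f}|%:R)^-1 * FinRing.uval (psi s)) s^-1%g.

End PicModP.

End Action.

Section Eta.
Variables (Y X : graph) (c : galois_cover Y X).
Local Notation ZG := (gring int (deck c)).

Lemma deck_free (s : deck c) w : deck_vert s w = w -> s = 1%g.
Proof.
move=> sw.
have edge_fix v e : deck_vert s v = v -> org e = v -> deck_edge s e = e.
  move=> sv ev; apply: (cover_star_inj (g := c) (w := v)).
  - by rewrite inE deck_org ev sv.
  - by rewrite inE ev.
  - exact: deck_hom_edge.
have fix_all v : deck_vert s v = v.
  have /connectP[q qP ->] := (cover_conn_top c).2 w v.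
  elim: q w sw qP => [//|u q IH] w sw /= /andP[/existsP[e /andP[/eqP ew /eqP eu]] qP].
  apply: IH qP; rewrite -eu -deck_tgt; congr tgt; exact: edge_fix ew.
apply: val_inj; rewrite [val s]surjective_pairing; congr pair.
  by apply/permP=> v; rewrite perm1; exact: fix_all.
by apply/permP=> e; rewrite perm1; exact: (edge_fix (org e)).
Qed.

(* A choice of one vertex in each fibre, and the resulting Z[G]-basis of
   [Div(Y)]; see [divG_coordE] and [divG_coordK]. *)
Definition lift_vert (v : vert X) : vert Y := xchoose (cover_surj c v).

Definition divG_basis (i : 'I_#|vert X|) : divG c := pt (lift_vert (enum_val i)).

Definition divG_coord (d : divG c) (i : 'I_#|vert X|) : ZG :=
  [ffun s => d (deck_vert s (lift_vert (enum_val i)))].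

Lemma lift_vertE v : hom_vert c (lift_vert v) = v.
Proof. exact/eqP/(xchooseP (cover_surj c v)). Qed.

Lemma deck_lift_inj (s t : deck c) (i j : 'I_#|vert X|) :
  deck_vert s (lift_vert (enum_val i)) = deck_vert t (lift_vert (enum_val j)) ->
  s = t /\ i = j.
Proof.
move=> E; have ij : i = j.
  move/(congr1 (hom_vert c)): E; rewrite !deck_hom_vert !lift_vertE.
  exact: enum_val_inj.
split=> //; subst j; apply/eqP; rewrite eq_sym eq_mulVg1; apply/eqP.
apply: (@deck_free _ (lift_vert (enum_val i))).
by rewrite deck_vertM E deck_vertK.
Qed.

Lemma scale_basisE (a : ZG) i w :
  (a *: divG_basis i) w = \sum_s a s * (w == deck_vert s (lift_vert (enum_val i)))%:R.
Proof.
rewrite [a *: _]/(gscale _ _ _ _) sum_ffunE; apply: eq_bigr => s _.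
by rewrite ffunMzE act_div_pt ffunE mulrC -mulrzr intz.
Qed.

Lemma divG_coordE (d : divG c) : d = \sum_i divG_coord d i *: divG_basis i.
Proof.
apply/ffunP=> w; rewrite sum_ffunE.
have [s Es] := cover_trans (lift_vertE (hom_vert c w)).
pose i := enum_rank (hom_vert c w).
rewrite (bigD1 i) //= scale_basisE (bigD1 s) //= ffunE enum_rankK Es eqxx mulr1.
rewrite big1 ?addr0 => [|t ts].
  rewrite big1 ?addr0 // => j ji; rewrite scale_basisE big1 // => t _.
  case: eqP => [E|_]; last by rewrite mulr0.
  have [_ /eqP] : s = t /\ i = j by apply: deck_lift_inj; rewrite enum_rankK Es.
  by rewrite eq_sym (negPf ji).
case: eqP => [E|_]; last by rewrite mulr0.
have [/eqP] : s = t /\ i = i by apply: deck_lift_inj; rewrite enum_rankK Es.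
by rewrite eq_sym (negPf ts).
Qed.

Lemma divG_coordK (a : 'I_#|vert X| -> ZG) j :
  divG_coord (\sum_i a i *: divG_basis i) j = a j.
Proof.
apply/ffunP=> s; rewrite ffunE sum_ffunE (bigD1 j) //= scale_basisE (bigD1 s) //=.
rewrite eqxx mulr1 !big1 ?addr0 // => [i ij|t ts].
  rewrite scale_basisE big1 // => t _; case: eqP => [E|_]; last by rewrite mulr0.
  by have [_ E'] := deck_lift_inj E; rewrite E' eqxx in ij.
case: eqP => [E|_]; last by rewrite mulr0.
by have [E' _] := deck_lift_inj E; rewrite E' eqxx in ts.
Qed.

(* The matrix over Z[G] of an endomorphism: the coordinates of the image of the
   j-th basis vector form the j-th column. *)
Definition divG_mx (T : divG c -> divG c) : 'M[ZG]_#|vert X| :=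
  \matrix_(i, j) divG_coord (T (divG_basis j)) i.

Lemma divG_mxE (T : divG c -> divG c) j :
  T (divG_basis j) = \sum_i divG_mx T i j *: divG_basis i.
Proof.
by rewrite [LHS]divG_coordE; apply: eq_bigr => i _; rewrite mxE.
Qed.

(* Meaningful when G is abelian, i.e. when Z[G] is commutative. *)
Definition eta : {poly ZG} :=
  \det (1%:M - 'X *: map_mx polyC (divG_mx (@adjOp Y))
        + 'X^2 *: (map_mx polyC (divG_mx (@degOp Y)) - 1%:M)).

Definition h1 (R : comNzRingType) (psi : deck c -> R) : R :=
  gring_ext psi eta.[1].

End Eta.

Arguments eta {Y X} c.
Arguments h1 {Y X} c {R} psi.

(* Main.v *)
(* Reducing psi-coordinates modulo p gives T : Div(Y) -> F_p^n, n = #V_X, with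
   T (sigma d) = psi(sigma) T d and T (L d) = M T d, where h(1, psi) = det M.
   If u M = 0 with u <> 0, the functional u T kills L(Div) and p Div, and it is
   nonzero on a degree-zero divisor (sigma - 1) w with psi(sigma) <> 1.
   If M is invertible, any d has T d = T (L b) for some b; since e_psi d modulo p
   only depends on T d, the class of e_psi d agrees with that of L (e_psi b). *)
Require Import Defs.
From HB Require Import structures.
From mathcomp Require Import all_boot all_order all_algebra all_fingroup.
From mathcomp Require Import finfield generic_quotient.

Set Implicit Arguments.
Unset Strict Implicit.

Import GRing.Theory Num.Theory.
Local Open Scope ring_scope.

Section GroupRingCharacter.
Variables (gT : finGroupType) (R : finComUnitRingType).
Variable psi : {morphism [set: gT] >-> {unit R}}.

(** Values are taken in [R] because they enter sums there; this is convertible to the function fed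
    to [h1] in the theorem. *)
Definition chi (g : gT) : R := FinRing.uval (psi g).

Lemma chi1 : chi 1%g = 1.
Proof. by rewrite /chi morph1. Qed.

Lemma chiM : {morph chi : g h / (g * h)%g >-> g * h}.
Proof. by move=> g h; rewrite /chi morphM ?inE. Qed.

Lemma chiVl g : chi g^-1%g * chi g = 1.
Proof. by rewrite -chiM mulVg chi1. Qed.

Lemma gring_ext_is_zmod_morphism : zmod_morphism (gring_ext chi).
Proof.
move=> a b; rewrite /gring_ext -sumrB; apply: eq_bigr => g _.
by rewrite !ffunE intrB mulrBl.
Qed.

HB.instance Definition _ := GRing.isZmodMorphism.Build (gring int gT) R
  (gring_ext chi) gring_ext_is_zmod_morphism.

Lemma gring_ext_is_monoid_morphism : monoid_morphism (gring_ext chi).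
Proof.
split=> [|a b]; rewrite /gring_ext.
  rewrite (bigD1 1%g) //= big1 => [|g g1].
    by rewrite ffunE eqxx chi1 mul1r addr0.
  by rewrite ffunE (negPf g1) mul0r.
transitivity (\sum_g \sum_h
    ((a h)%:~R * chi h) * ((b (h^-1 * g)%g)%:~R * chi (h^-1 * g)%g)).
  apply: eq_bigr => g _; rewrite ffunE rmorph_sum /= mulr_suml.
  by apply: eq_bigr => h _; rewrite mulrACA -chiM mulKVg rmorphM.
rewrite exchange_big /= mulr_suml; apply: eq_bigr => h _.
by rewrite mulr_sumr [RHS](reindex_inj (mulgI h^-1%g)).
Qed.

HB.instance Definition _ := GRing.isMonoidMorphism.Build (gring int gT) R
  (gring_ext chi) gring_ext_is_monoid_morphism.

End GroupRingCharacter.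

Lemma lapOp_act (Y X : graph) (f : graph_hom Y X) (s : deck f) (d : divisor Y) :
  lapOp (act_div s d) = act_div s (lapOp d).
Proof. by rewrite /lapOp raddfB /= act_degOp act_adjOp. Qed.

Lemma divisor_ptE (Y : graph) (d : divisor Y) : d = \sum_w pt w *~ d w.
Proof.
apply/ffunP=> w; rewrite sum_ffunE (bigD1 w) //= big1 => [|v vw].
  by rewrite ffunMzE ffunE eqxx intz addr0.
by rewrite ffunMzE ffunE eq_sym (negPf vw) mul0rz.
Qed.

Section PicModClass.
Variables (Y X : graph) (f : graph_hom Y X) (p : nat) (p_pr : prime p).

Definition pic_class (x : div0 Y) : pic_mod f p_pr := to_coker _ (to_coker _ x).

Lemma pic_class_surj (y : pic_mod f p_pr) : exists x, y = pic_class x.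
Proof. by exists (repr (repr y)); rewrite /pic_class !to_cokerK. Qed.

(** Vanishing means x = L b + p q with q of degree zero. The degree condition comes for free: p
    times the degree of q is the degree of x - L b, which is 0, and the integers have no torsion. *)
Lemma pic_class_eq0 (x : div0 Y) : pic_class x = 0 <->
  exists b : divisor Y, forall w, (val x w)%:~R = (lapOp b w)%:~R :> 'F_p.
Proof.
have p_ch := pchar_Fp p_pr.
split=> [x0|[b bE]].
  have /to_coker_eq[u uE] : pic_class x = to_coker (@mul_by (pic0 Y) p) 0.
    by rewrite x0 raddf0.
  have /to_coker_eq[b bE] : to_coker (@laplacian Y) (mul_by p (repr u)) = to_coker _ x.
    by rewrite -[RHS]subr0 -uE /mul_by raddfMn /= to_cokerK.
  (* Here L b = p r - x with r = [repr u], hence the sign. *)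
  exists (- b) => w; apply/eqP; rewrite -subr_eq0 -rmorphB /= -(dvdz_pcharf p_ch).
  have := congr1 (fun d : div0 Y => (val d : divisor Y) w) bE.
  rewrite raddfN /= !ffunE -[div0_val _]/(val _) /mul_by raddfMn /= ffunMnE => ->.
  rewrite opprK addrC subrK -mulr_natr natz.
  exact: dvdz_mull.
(* The division is exact, by the congruence [bE]. *)
pose q : divisor Y := [ffun w => ((val x w - lapOp b w) %/ p)%Z].
have qE : val x - lapOp b = q *+ p.
  apply/ffunP=> w; rewrite ffunMnE !ffunE -mulr_natr natz divzK //.
  by rewrite (dvdz_pcharf p_ch) rmorphB /= bE !ffunE subrr.
have q0 : q \in @deg_zero Y.
  have /eqP : augm (q *+ p) = 0.
    by rewrite -qE raddfB /= (eqP (div0P x)) (eqP (lapOp_deg_zero b)) subrr.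
  by rewrite raddfMn /= mulrn_eq0 -[p == 0]negbK -lt0n prime_gt0.
rewrite /pic_class.
have -> : to_coker (@laplacian Y) x = mul_by p (to_coker _ (Div0 q0)).
  rewrite /mul_by -raddfMn; apply/to_coker_eq; exists b; apply: val_inj.
  by rewrite raddfB raddfMn /= -qE opprB addrC subrK.
rewrite -[RHS](raddf0 (to_coker (@mul_by (pic0 Y) p))).
by apply/to_coker_eq; exists (to_coker _ (Div0 q0)); rewrite subr0.
Qed.

End PicModClass.

Section Isotypic.
Variables (p : nat) (p_pr : prime p) (Y X : graph) (c : galois_cover Y X).
Variable psi : {morphism [set: deck c] >-> {unit 'F_p}}.

Local Notation n := #|vert X|.
Local Notation base i := (lift_vert c (enum_val i)).

(** The map T: [psi] applied to the coordinates of d over Z[G]. *)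
Definition psi_coord (d : divisor Y) : 'cV['F_p]_n :=
  \col_i gring_ext (chi psi) (divG_coord (c := c) d i).

Definition psi_lap_mx : 'M['F_p]_n :=
  \matrix_(i, j) psi_coord (lapOp (divG_basis c j)) i 0.

(** A lift of e_psi to integral divisors, each coefficient in F_p being replaced by its
    representative in [0, p). Only its values modulo p matter. *)
Definition psi_idem_lift (d : divisor Y) : divisor Y :=
  \sum_(s : deck c) act_div s d *+ (psi_idem psi s : nat).

Lemma deck_liftP (w : vert Y) : exists (s : deck c) (i : 'I_n), w = deck_vert s (base i).
Proof.
have [s Es] := cover_trans (lift_vertE c (hom_vert c w)).
by exists s, (enum_rank (hom_vert c w)); rewrite enum_rankK.
Qed.

Lemma psi_coordE d i :
  psi_coord d i 0 = \sum_s (d (deck_vert s (base i)))%:~R * chi psi s.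
Proof. by rewrite mxE; apply: eq_bigr => s _; rewrite ffunE. Qed.

Lemma psi_coord_is_zmod_morphism : zmod_morphism psi_coord.
Proof.
move=> a b; apply/colP=> i; rewrite !mxE -raddfB; congr gring_ext.
by apply/ffunP=> s; rewrite !ffunE.
Qed.

HB.instance Definition _ := GRing.isZmodMorphism.Build (divisor Y) 'cV['F_p]_n
  psi_coord psi_coord_is_zmod_morphism.

Lemma psi_coord_eq_modp (d d' : divisor Y) :
  (forall w, (d w)%:~R = (d' w)%:~R :> 'F_p) -> psi_coord d = psi_coord d'.
Proof.
move=> dd'; apply/colP=> i; rewrite !psi_coordE.
by apply: eq_bigr => s _; rewrite dd'.
Qed.

Lemma psi_coord_act s d : psi_coord (act_div s d) = chi psi s *: psi_coord d.
Proof.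
apply/colP=> i; rewrite [RHS]mxE !psi_coordE mulr_sumr (reindex_inj (mulgI s)).
apply: eq_bigr => t _; rewrite act_divE -deck_vertM mulKg chiM.
by rewrite mulrCA.
Qed.

Lemma psi_coord_basis i : psi_coord (divG_basis c i) = delta_mx i 0.
Proof.
apply/colP=> j; rewrite psi_coordE mxE andbT /divG_basis.
have [->|ji] := eqVneq j i.
  rewrite (bigD1 1%g) //= big1 => [|s s1].
    by rewrite ffunE deck_vert1 eqxx mul1r chi1 addr0.
  rewrite ffunE; case: eqP => [E|_]; last by rewrite mul0r.
  by rewrite (deck_free E) eqxx in s1.
rewrite big1 // => s _; rewrite ffunE; case: eqP => [E|_]; last by rewrite mul0r.
rewrite -[RHS](deck_vert1 c) in E; have [_ E'] := deck_lift_inj E.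
by rewrite E' eqxx in ji.
Qed.

(** Both sides are additive in d and are scaled by [chi psi s] under the action of s, so it suffices
    to compare them on the basis divisors, where they give the columns of M. *)
Lemma psi_coord_lap d : psi_coord (lapOp d) = psi_lap_mx *m psi_coord d.
Proof.
rewrite (divisor_ptE d) !raddf_sum; apply: eq_bigr => w _.
rewrite !raddfMz; congr (_ *~ _).
have [s [i ->]] := deck_liftP w; rewrite -(act_div_pt s) /= lapOp_act !psi_coord_act.
rewrite -scalemxAr; congr (_ *: _); rewrite psi_coord_basis -colE.
by apply/colP=> j; rewrite !mxE.
Qed.

Lemma psi_coord_surj (v : 'cV['F_p]_n) : exists d, psi_coord d = v.
Proof.
exists (\sum_i divG_basis c i *+ (v i 0 : nat)); rewrite raddf_sum.
rewrite [RHS]matrix_sum_delta; apply: eq_bigr => i _.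
by rewrite big_ord1 raddfMn /= psi_coord_basis -scaler_nat natr_Zp.
Qed.

(** Applying [psi] and setting u = 1 compose to a ring morphism, which commutes with the
    determinant. At u = 1 the identity terms cancel and D - A remains. *)
Lemma h1_det : h1 c (fun s => FinRing.uval (psi s)) = \det psi_lap_mx.
Proof.
rewrite -[LHS]/(gring_ext (chi psi) (Defs.eta c).[1]).
pose ev : {rmorphism {poly gring int (deck c)} -> 'F_p} :=
  horner_eval 1 \o map_poly (gring_ext (chi psi)).
have evC a : ev a%:P = gring_ext (chi psi) a.
  by rewrite /ev /= map_polyC /horner_eval hornerC.
have evX : ev 'X = 1 by rewrite /ev /= map_polyX /horner_eval hornerX.
rewrite -horner_map rmorph1 -[LHS]/(ev (Defs.eta c)) /Defs.eta -det_map_mx.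
congr (\det _); apply/matrixP=> i j; rewrite !mxE.
rewrite rmorphD rmorphB !rmorphM evX !mul1r rmorphB !evC addrC addrA subrK.
rewrite -raddfB; congr gring_ext.
by apply/ffunP=> s; rewrite !ffunE.
Qed.

Lemma psi_idemE s : psi_idem psi s = #|{: deck c}|%:R^-1 * chi psi s^-1%g.
Proof.
rewrite /psi_idem sum_ffunE (bigD1 s^-1%g) //= ffunE invgK eqxx big1 ?addr0 //.
by move=> t ts; rewrite ffunE -(inj_eq invg_inj) invgK eq_sym (negPf ts).
Qed.

(** Since e_psi projects onto the [psi]-part, d enters only through T d. *)
Lemma psi_idem_lift_modp d s (i : 'I_n) :
  (psi_idem_lift d (deck_vert s (base i)))%:~R =
    #|{: deck c}|%:R^-1 * chi psi s^-1%g * psi_coord d i 0.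
Proof.
rewrite /psi_idem_lift sum_ffunE rmorph_sum psi_coordE mulr_sumr /=.
(* Replacing t by the inverse of t s^-1 moves the evaluation points to t applied to the base vertex,
   as in [psi_coord]. *)
rewrite (reindex_inj invg_inj) (reindex_inj (mulIg s^-1%g)) /=.
apply: eq_bigr => t _; rewrite ffunMnE act_divE invgK -deck_vertM mulgKV.
rewrite rmorphMn /= -mulr_natr natr_Zp psi_idemE invgK chiM.
by rewrite mulrCA -mulrA [in RHS](mulrCA (chi psi s^-1%g)) [chi psi s^-1%g * _]mulrC.
Qed.

(** The factors [chi psi s] and [chi psi s^-1] cancel, leaving #G equal terms against the factor
    1/#G. *)
Lemma psi_coord_idem_lift d :
  #|{: deck c}|%:R != 0 :> 'F_p -> psi_coord (psi_idem_lift d) = psi_coord d.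
Proof.
move=> G0; apply/colP=> i; rewrite psi_coordE.
under eq_bigr => s _.
  rewrite psi_idem_lift_modp mulrAC -(mulrA _ (chi psi s^-1%g)) chiVl mulr1.
  over.
by rewrite sumr_const -[LHS]mulr_natl mulrA mulfV // mul1r.
Qed.

Lemma lapOp_idem_lift d : lapOp (psi_idem_lift d) = psi_idem_lift (lapOp d).
Proof.
rewrite /psi_idem_lift raddf_sum; apply: eq_bigr => s _.
by rewrite raddfMn /= lapOp_act.
Qed.

Lemma psi_idem_lift_deg_zero (x : div0 Y) : psi_idem_lift (val x) \in @deg_zero Y.
Proof.
apply/eqP; rewrite /psi_idem_lift raddf_sum big1 // => s _.
by rewrite raddfMn /= augm_act (eqP (div0P x)) mul0rn.
Qed.

(** Scaling by F_p on the quotient also uses representatives in [0, p), so the lift matches term by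
    term. *)
Lemma psi_idem_pic_class (x : div0 Y) :
  psi_idem psi *: pic_class c p_pr x = pic_class c p_pr (Div0 (psi_idem_lift_deg_zero x)).
Proof.
rewrite [LHS]/(gscale _ _ _ _).
transitivity (\sum_s pic_class c p_pr (act_div0 s x *+ (psi_idem psi s : nat))).
  apply: eq_bigr => s _; rewrite act_modE act_pic0E /pic_class.
  by rewrite !raddfMn.
rewrite /pic_class -!raddf_sum; congr (to_coker _ (to_coker _ _)).
apply: val_inj; rewrite raddf_sum /=; apply: eq_bigr => s _.
exact: (raddfMn (val : div0 Y -> divisor Y)).
Qed.

End Isotypic.

Theorem theorem1 (p : nat) (p_pr : prime p) (p_odd : odd p)
    (Y X : graph) (c : galois_cover Y X)
    (Delta_iso : [set: deck c] \isog [set: {unit 'F_p}])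
    (psi : {morphism [set: deck c] >-> {unit 'F_p}})
    (psi_nontrivial : exists s : deck c, psi s != 1%g) :
  (exists x : pic_mod c p_pr, psi_idem psi *: x != 0) <->
  h1 c (fun s : deck c => FinRing.uval (psi s)) = 0.
Proof.
(* The order of G is p - 1, and 0 < p - 1 < p. *)
have G0 : #|{: deck c}|%:R != 0 :> 'F_p.
  rewrite -cardsT (card_isog Delta_iso) card_finField_unit card_Fp //.
  rewrite -(dvdn_pcharf (pchar_Fp p_pr)) -subn1.
  by rewrite gtnNdvd ?subn_gt0 ?ltn_subrL ?(prime_gt1 p_pr) ?(prime_gt0 p_pr).
rewrite h1_det; split=> [[x]|/eqP/det0P[u u0 uM]].
  apply: contra_neq_eq => M0.
  have [d ->] := pic_class_surj x; rewrite psi_idem_pic_class.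
  apply/pic_class_eq0 => /=.
  (* This choice of T b gives T (L b) = M T b = T d. *)
  have [b bE] := psi_coord_surj psi (invmx (psi_lap_mx psi) *m psi_coord psi (val d)).
  exists (psi_idem_lift psi b) => w; have [s [i ->]] := deck_liftP c w.
  rewrite lapOp_idem_lift !psi_idem_lift_modp psi_coord_lap bE mulKVmx //.
  by rewrite unitmxE unitfE.
have [i ui] : exists i, u 0 i != 0 by apply/rV0Pn.
have [s s1] := psi_nontrivial.
(* T d is psi(s) - 1 times the i-th unit vector, on which u does not vanish. *)
pose d : divisor Y := act_div s (divG_basis c i) - divG_basis c i.
have d0 : d \in @deg_zero Y by apply/eqP; rewrite raddfB /= augm_act subrr.
exists (pic_class c p_pr (Div0 d0)); rewrite psi_idem_pic_class.
(* If the class were zero, applying u T to the congruence would give (psi(s) - 1) u_i = u M T b =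
   0. *)
apply/eqP => /pic_class_eq0[b /(psi_coord_eq_modp psi)/(congr1 (mulmx u))/eqP].
rewrite psi_coord_lap mulmxA uM mul0mx /= psi_coord_idem_lift //.
rewrite raddfB /= psi_coord_act psi_coord_basis -{2}[delta_mx i 0]scale1r.
rewrite -scalerBl -scalemxAr -colE scaler_eq0 subr_eq0 => /orP[/eqP chi_s|/eqP ui0].
  by case/eqP: s1; apply: val_inj.
by move/colP/(_ 0): ui0; rewrite !mxE => /eqP; apply/negP.
Qed.
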